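(* Let $n,k$ be positive integers with $k>n$. For any complex number $t$ such that $\lvert t\rvert\leq 1$, we have \[\sum_{r=1}^n\ \sum_{\mathbf{k}\in I'(r)}\ \sum_{m_1,\ldots,m_n=1}^\infty\frac{1-(1-t^{m_1})(1-t^{m_2})\cdots(1-t^{m_r})}{m_1^{k_1}(m_1+m_2)^{k_2}\cdots(m_1+\cdots+m_n)^{k_n}}=\mathit{Li}_k(t).\]
   Context: $\mathbb{N}=\{1,2,\ldots\}$. For fixed $n,k\in\mathbb{N}$ with $k>n$ and $r\in\{1,\ldots,n\}$, \[I(r)=\bigl\{\mathbf{k}=(k_1,\ldots,k_n)\in\mathbb{N}^n \bigm| k_n\geq 2,\ k_1+\cdots+k_n=k,\ k_1=\cdots=k_{r-1}=1\bigr\},\] and $I(n+1)=\emptyset$. Put $I'(r)=I(r)\setminus I(r+1)$ for $r=1,\ldots,n$. The polylogarithm is $\mathit{Li}_k(t)=\sum_{m=1}^\infty\frac{t^m}{m^k}$. *)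

(* Defs.v *)
From HB Require Import structures.
From mathcomp Require Import all_boot all_order all_algebra.
From mathcomp Require Import all_classical all_reals all_analysis.
From mathcomp Require Import complex.
From mathcomp Require summability.
Import Order.TTheory GRing.Theory Num.Theory.
Import numFieldNormedType.Exports.

Set Implicit Arguments.
Unset Strict Implicit.
Unset Printing Implicit Defensive.

Local Open Scope classical_set_scope.
Local Open Scope ring_scope.

(* Indices are 0-based: [kk i] is k_(i+1).  The entries are positive and sum
   to k, so bounding them by k in the type loses nothing. *)
Definition index_set (n k r : nat) : {set {ffun 'I_n -> 'I_k.+1}} :=
  [set kk : {ffun 'I_n -> 'I_k.+1} |
    [&& (r <= n)%N,
        [forall i, (0 < kk i)%N],
        [forall i : 'I_n, (i.+1 == n) ==> (2 <= kk i)%N],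
        (\sum_i kk i == k)%N &
        [forall i : 'I_n, (i.+1 < r)%N ==> (kk i == 1 :> nat)]]].

Definition index_set' (n k r : nat) : {set {ffun 'I_n -> 'I_k.+1}} :=
  (index_set n k r :\: index_set n k r.+1)%SET.

(* The summation variables m_1, ..., m_n >= 1 are m_(i+1) = (m i).+1, where m
   ranges over all functions 'I_n -> nat. *)
Definition mterm (K : numFieldType) (n k r : nat)
    (kk : {ffun 'I_n -> 'I_k.+1}) (t : K) (m : {ffun 'I_n -> nat}) : K :=
  (1 - \prod_(i < n | (i < r)%N) (1 - t ^+ (m i).+1)) /
  \prod_(j < n) ((\sum_(i < n | (i <= j)%N) (m i).+1)%N)%:R ^+ kk j.

(* Multiple series are unordered sums: limits of the finite partial sums along
   the directed set of finite subsets of the index type. *)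
Definition multi_summable (K : numFieldType) (I : choiceType) (f : I -> K) :=
  cvg (summability.partial_sum f @ summability.totally).

Definition multi_sum (K : numFieldType) (I : choiceType) (f : I -> K) : K :=
  summability.sum f.

Definition polylog_partial (K : numFieldType) (k : nat) (t : K) : K^nat :=
  fun N => \sum_(1 <= m < N) t ^+ m / m%:R ^+ k.

Definition polylog (K : numFieldType) (k : nat) (t : K) : K :=
  lim (polylog_partial k t @ \oo).

(* Main.v *)
Require Import Defs.
From mathcomp Require Import all_boot all_order all_algebra.
From mathcomp Require Import finmap ring zify.
From mathcomp Require Import all_classical all_reals all_analysis.
From mathcomp Require Import complex summability.
Import Order.TTheory GRing.Theory Num.Theory.
Import numFieldNormedType.Exports.
Local Open Scope classical_set_scope.
Local Open Scope complex_scope.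
Local Open Scope ring_scope.

(* Write p_j = m_1 + ... + m_j and put
     M_j(p) = sum over m_1 + ... + m_j = p of
                (1 - t^(m_1)) ... (1 - t^(m_j)) / (p_1 ... p_j),
     B_j(p) = sum over q < p of M_j(q) t^(p - q),
   which are polynomials in t.  The numerator of a summand telescopes into the
   terms t^(m_s) (1 - t^(m_1)) ... (1 - t^(m_(s-1))) with s <= r, so the part of
   the left-hand side with p_n = p is a nested sum built on B_0, ..., B_(n-1).
   With theta = t d/dt one has
     theta B_j(p) = p B_j(p) - sum over q < p of B_(j-1)(q),
   and this makes the nested sum collapse, for each p separately:
   its coefficient at t^N is N^(n-k) [t^N] B_(n-1)(p) / p.
   It remains to see that c_N(P) = sum over p <= P of [t^N] B_(n-1)(p) / p tends
   to N^(-n).  The same formula, summed over p <= P, yields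
   N c_N = (the c_N for n - 1) + defect, where the defect is
   - t / (1 - t) * sum over q <= P of M_(n-1)(q) t^(P - q).
   Bounding its coefficients by powers of the harmonic number H_P shows that
   the part of the left-hand side with p_n <= P differs from the P-th partial
   sum of Li_k(t) by O(H_P^(n-1) / P), uniformly in |t| <= 1. *)

(** * The polynomials M_j(p) and B_j(p) *)

Lemma sum_triangle (V : nmodType) (p : nat) (F : nat -> nat -> V) :
  \sum_(0 <= q < p) \sum_(0 <= r < q) F q r =
  \sum_(0 <= r < p) \sum_(r.+1 <= q < p) F q r.
Proof.
elim: p => [|p IHp]; first by rewrite !big_geq.
rewrite big_nat_recr //= IHp [in RHS]big_nat_recr //= [in X in _ = _ + X]big_geq //.
rewrite addr0 -big_split /=.
by apply: eq_big_nat => r /andP[_ rp]; rewrite big_nat_recr.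
Qed.

(* In the notation of the header, with 'X for t, [front j p] is
   M_j(p) and [back j p] is B_j(p). *)
Fixpoint front (K : numFieldType) (j p : nat) : {poly K} :=
  if j is i.+1 then
    p%:R^-1 *: \sum_(0 <= q < p) front K i q * (1 - 'X^(p - q))
  else (p == 0)%:R.

Arguments front : simpl never.

Definition back (K : numFieldType) (j p : nat) : {poly K} :=
  \sum_(0 <= q < p) front K j q * 'X^(p - q).

Definition theta (K : numFieldType) (f : {poly K}) : {poly K} := 'X * f^`().

Section Euler.
Variable K : numFieldType.
Local Notation front := (front K).
Local Notation back := (back K).
Local Notation theta := (@theta K).

Lemma scale_nat (n : nat) (f : {poly K}) : n%:R *: f = n%:R * f.
Proof. by rewrite scaler_nat mulr_natl. Qed.

Lemma coef_natM (n N : nat) (f : {poly K}) : (n%:R * f)`_N = n%:R * f`_N.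
Proof. by rewrite -scale_nat coefZ. Qed.

Lemma theta_coef (f : {poly K}) (N : nat) : (theta f)`_N = N%:R * f`_N.
Proof.
by rewrite /theta coefXM coef_deriv; case: N => [|N] /=; rewrite ?mul0r // mulr_natl.
Qed.

Lemma thetaB : {morph theta : f g / f - g}.
Proof. by move=> f g; rewrite /theta derivB mulrBr. Qed.

Lemma thetaZ (a : K) (f : {poly K}) : theta (a *: f) = a *: theta f.
Proof. by rewrite /theta derivZ scalerAr. Qed.

Lemma thetaM (f g : {poly K}) : theta (f * g) = theta f * g + f * theta g.
Proof. by rewrite /theta derivM; ring. Qed.

Lemma thetaX (n : nat) : theta 'X^n = n%:R * 'X^n.
Proof.
rewrite /theta derivXn -mulr_natl; case: n => [|n]; first by rewrite !mul0r mulr0.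
by rewrite /= exprS; ring.
Qed.

Lemma theta_sum (I : Type) (s : seq I) (P : pred I) (F : I -> {poly K}) :
  theta (\sum_(i <- s | P i) F i) = \sum_(i <- s | P i) theta (F i).
Proof. by rewrite /theta raddf_sum mulr_sumr. Qed.

Lemma frontS (j p : nat) :
  front j.+1 p = p%:R^-1 *: \sum_(0 <= q < p) front j q * (1 - 'X^(p - q)).
Proof. by []. Qed.

Lemma front_step (j p : nat) :
  p%:R *: front j.+1 p = \sum_(0 <= q < p) front j q * (1 - 'X^(p - q)).
Proof.
case: p => [|p]; first by rewrite scale0r big_geq.
by rewrite frontS scalerA mulfV ?scale1r // pnatr_eq0.
Qed.

Lemma front0 (j : nat) : front j.+1 0 = 0.
Proof. by rewrite frontS big_geq // scaler0. Qed.

Lemma back_at0 (j : nat) : back j 0 = 0.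
Proof. by rewrite /back big_geq. Qed.

Lemma back0 (p : nat) : back 0 p = if p is 0 then 0 else 'X^p.
Proof.
rewrite /back; case: p => [|p]; first by rewrite big_geq.
rewrite big_nat_recl // /front /= mul1r subn0 big1 ?addr0 // => i _.
by rewrite mul0r.
Qed.

(* Expanding both sides over pairs r < q < p, the reflection q <-> p + r - q
   exchanges them. *)
Lemma back_front_swap (j p : nat) :
  \sum_(0 <= q < p) back j q * (1 - 'X^(p - q)) =
  \sum_(0 <= q < p) (q%:R *: front j.+1 q) * 'X^(p - q).
Proof.
transitivity (\sum_(0 <= q < p) \sum_(0 <= r < q)
    front j r * ('X^(q - r) - 'X^(p - r))).
  apply: eq_big_nat => q /andP[_ qp]; rewrite /back mulr_suml.
  apply: eq_big_nat => r /andP[_ rq].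
  have -> : (p - r = (q - r) + (p - q))%N by lia.
  by rewrite exprD; ring.
transitivity (\sum_(0 <= q < p) \sum_(0 <= r < q)
    front j r * ('X^(p - q) - 'X^(p - r))); last first.
  apply: eq_big_nat => q /andP[_ qp]; rewrite front_step mulr_suml.
  apply: eq_big_nat => r /andP[_ rq].
  have -> : (p - r = (q - r) + (p - q))%N by lia.
  by rewrite exprD; ring.
rewrite !sum_triangle; apply: eq_big_nat => r _.
rewrite big_nat_rev; apply: eq_big_nat => q /andP[rq qp].
by congr (_ * ('X^_ - _)); lia.
Qed.

Lemma theta_nat (n : nat) : theta n%:R = 0.
Proof. by rewrite /theta -polyC_natr derivC mulr0. Qed.

(** Apply theta to p times the recursion for [front]. By induction theta of [front] is minus [back],
    [back_front_swap] turns these terms into q M(q) 'X^(p - q), and q + (p - q) = p then assembles p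
    times [back j p]. *)
Lemma theta_front (j p : nat) : theta (front j.+1 p) = - back j p.
Proof.
elim: j p => [|j IHj] [|p];
  try by rewrite front0 /back big_geq // -[0]/(0%:R) theta_nat oppr0.
all: have p_neq0 : p.+1%:R != 0 :> K by rewrite pnatr_eq0.
all: apply: (scalerI p_neq0); rewrite -thetaZ front_step theta_sum scalerN.
all: rewrite /back scaler_sumr -sumrN.
  apply: eq_big_nat => q /andP[_ qp].
  rewrite thetaM thetaB thetaX (theta_nat 1) theta_nat mul0r add0r.
  rewrite /front; case: q qp => [|q] qp /=; first by rewrite sub0r subn0 !mul1r scale_nat.
  by rewrite !mul0r scaler0 oppr0.
transitivity (- \sum_(0 <= q < p.+1) back j q * (1 - 'X^(p.+1 - q))
   - \sum_(0 <= q < p.+1) (p.+1 - q)%:R * (front j.+1 q * 'X^(p.+1 - q))).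
  rewrite -!sumrN -big_split; apply: eq_big_nat => q /andP[_ qp] /=.
  by rewrite thetaM thetaB thetaX (theta_nat 1) IHj; ring.
rewrite back_front_swap -!sumrN -big_split; apply: eq_big_nat => q /andP[_ qp] /=.
by rewrite natrB 1?ltnW // !scale_nat; ring.
Qed.

Lemma theta_back0 (p : nat) : theta (back 0 p) = p%:R * back 0 p.
Proof. by rewrite back0; case: p => [|p]; rewrite ?thetaX // (theta_nat 0) mulr0. Qed.

(** Splitting 1 as 'X^(p - q) + (1 - 'X^(p - q)) in the last sum lets [back_front_swap] apply; after
    that the identity holds term by term in q. *)
Lemma theta_back (j p : nat) :
  theta (back j.+1 p) = p%:R * back j.+1 p - \sum_(0 <= q < p) back j q.
Proof.
have -> : \sum_(0 <= q < p) back j q =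
    \sum_(0 <= q < p) back j q * 'X^(p - q) +
    \sum_(0 <= q < p) (q%:R *: front j.+1 q) * 'X^(p - q).
  by rewrite -back_front_swap -big_split; apply: eq_bigr => q _ /=; ring.
rewrite {1 2}/back theta_sum mulr_sumr -big_split -sumrB.
apply: eq_big_nat => q /andP[_ qp] /=.
rewrite thetaM thetaX theta_front natrB 1?ltnW // scale_nat; ring.
Qed.

(** Each [front j q] occurs with the geometric sum 'X + ... + 'X^(P - q). The factor 1 - 'X closes
    it to 'X times 1 - 'X^(P - q), which is the factor in the recursion for [front j.+1 P]. *)
Lemma sum_back (j P : nat) :
  (1 - 'X) * \sum_(0 <= p < P.+1) back j p = 'X * (P%:R *: front j.+1 P).
Proof.
rewrite front_step big_nat_recl //= back_at0 add0r.
elim: P => [|P IHP]; first by rewrite !big_geq // !mulr0.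
rewrite big_nat_recr //= mulrDr IHP [in RHS]big_nat_recr //= /back.
rewrite !mulr_sumr big_nat_recr //= mulrDr addrA -big_split.
rewrite mulr_sumr mulrDr; congr (_ + _); last first.
  by rewrite subSn // subnn; ring.
apply: eq_big_nat => q /andP[_ qP] /=.
by rewrite subSn 1?ltnW // exprS; ring.
Qed.

Lemma front_coef_gt (j p N : nat) : (p < N)%N -> (front j p)`_N = 0.
Proof.
elim: j p N => [|j IHj] p N pN.
  rewrite /front; by case: p pN => [|p] pN; rewrite ?coef0 // coef1; case: N pN.
rewrite frontS coefZ coef_sum big_nat big1 ?mulr0 // => q /andP[_ qp].
rewrite mulrBr mulr1 coefB coefMXn !IHj ?subr0 //; try by lia.
by case: ifP => [_|_]; rewrite ?IHj ?subr0 //; lia.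
Qed.

Lemma back_coef_gt (j p N : nat) : (p < N)%N -> (back j p)`_N = 0.
Proof.
move=> pN; rewrite /back coef_sum big_nat big1 // => q /andP[_ qp].
by rewrite coefMXn; case: ifP => // _; rewrite front_coef_gt //; lia.
Qed.

Lemma back_coef0 (j p : nat) : (back j p)`_0 = 0.
Proof.
rewrite /back coef_sum big_nat big1 // => q /andP[_ qp].
by rewrite coefMXn subn_gt0 qp.
Qed.

(** The constant term vanishes, so N may start at 1 and can be divided by later. The free bound Q
    gives the polynomials for different p a common range of N. *)
Lemma horner_back (j p Q : nat) (t : K) : (p < Q)%N ->
  (back j p).[t] = \sum_(1 <= N < Q) (back j p)`_N * t ^+ N.
Proof.
move=> pQ; rewrite (@horner_coef_wide _ Q).
  case: Q pQ => // Q _; rewrite -(big_mkord predT (fun i => (back j p)`_i * t ^+ i)).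
  by rewrite big_ltn // back_coef0 mul0r add0r.
by apply/leq_sizeP => N QN; rewrite back_coef_gt //; lia.
Qed.

Lemma back_coef_step (j p N : nat) :
  \sum_(0 <= q < p) (back j q)`_N = (p%:R - N%:R) * (back j.+1 p)`_N.
Proof.
have /(congr1 (fun f : {poly K} => f`_N)) := theta_back j p.
by rewrite -coef_sum theta_coef coefB coef_natM mulrBl => ->; ring.
Qed.

Lemma back0_coef_step (p N : nat) : (p%:R - N%:R) * (back 0 p)`_N = 0.
Proof.
have /(congr1 (fun f : {poly K} => f`_N)) := theta_back0 p.
by rewrite theta_coef coef_natM mulrBl => ->; rewrite subrr.
Qed.
End Euler.

(** * Bounding the defect *)

Definition harmonic_sum (K : numFieldType) (P : nat) : K :=
  \sum_(1 <= i < P.+1) i%:R^-1.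

(** This is c_N(P) of the header, with j for n - 1. *)
Definition coef_sum_back (K : numFieldType) (j P N : nat) : K :=
  \sum_(1 <= p < P.+1) (back K j p)`_N / p%:R.

(** The error term that arises when [theta_back] is divided by p and summed over p. The inner sum
    includes q = p so that [sum_back] applies to it; the added term is what produces
    [coef_sum_back j] in [coef_sum_back_step]. *)
Definition defect (K : numFieldType) (j P : nat) : {poly K} :=
  \sum_(0 <= p < P.+1) back K j.+1 p -
  \sum_(1 <= p < P.+1) p%:R^-1 *: \sum_(0 <= q < p.+1) back K j q.

Definition remainder (K : numFieldType) (j P : nat) : {poly K} :=
  \sum_(0 <= q < P.+1) front K j.+1 q * 'X^(P - q).

Definition l1norm (K : numFieldType) (Q : nat) (f : {poly K}) : K :=
  \sum_(0 <= i < Q) `|f`_i|.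

Section Estimate.
Variable K : numFieldType.
Local Notation front := (front K).
Local Notation back := (back K).
Local Notation H := (harmonic_sum K).
Local Notation coef_sum_back := (coef_sum_back K).
Local Notation defect := (defect K).
Local Notation remainder := (remainder K).
Local Notation l1norm := (@l1norm K).

Lemma coef_sum_back_step (j P N : nat) :
  N%:R * coef_sum_back j.+1 P N = coef_sum_back j P N + (defect j P)`_N.
Proof.
rewrite /defect big_ltn // back_at0 add0r coefB !coef_sum -sumrB.
rewrite /coef_sum_back mulr_sumr -big_split; apply: eq_big_nat => p /andP[p_gt0 _] /=.
have p_neq0 : p%:R != 0 :> K by rewrite pnatr_eq0 -lt0n.
rewrite coefZ; have -> : (\sum_(0 <= q < p.+1) back j q)`_N =
    (p%:R - N%:R) * (back j.+1 p)`_N + (back j p)`_N.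
  by rewrite big_nat_recr //= coefD -back_coef_step -coef_sum.
by field.
Qed.

(** With M = [front j.+1], [sum_back] turns the first sum into 'X times the sum of M(q) (1 - 'X^(P -
    q)) and the second into 'X times the sum of M(q); only the terms with powers survive. *)
Lemma defectE (j P : nat) : (1 - 'X) * defect j P = - ('X * remainder j P).
Proof.
have tail : (1 - 'X) *
    \sum_(1 <= p < P.+1) p%:R^-1 *: \sum_(0 <= q < p.+1) back j q =
    'X * \sum_(1 <= p < P.+1) front j.+1 p.
  rewrite !mulr_sumr; apply: eq_big_nat => p /andP[p_gt0 _].
  rewrite -[LHS]scalerAr sum_back -[in LHS]scalerAr scalerA mulVf ?scale1r //.
  by rewrite pnatr_eq0 -lt0n.
rewrite /defect mulrBr sum_back front_step tail -mulrBr -mulrN; congr (_ * _).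
have -> : \sum_(1 <= p < P.+1) front j.+1 p = \sum_(0 <= p < P.+1) front j.+1 p.
  by rewrite [RHS]big_ltn // front0 add0r.
rewrite [X in _ - X]big_nat_recr //= /remainder opprD addrA -sumrB.
rewrite [X in _ = - X]big_nat_recr //= subnn mulr1 opprD; congr (_ - _).
by rewrite -sumrN; apply: eq_bigr => q _; ring.
Qed.

(** Division by 1 - 'X replaces coefficients by their prefix sums; induction on N avoids power
    series. *)
Lemma coef_telescope (D S : {poly K}) (N : nat) :
  (1 - 'X) * D = - ('X * S) -> D`_N = - \sum_(0 <= i < N) S`_i.
Proof.
move=> DS; have DSi i : D`_i - ('X * D)`_i = - ('X * S)`_i.
  by rewrite -coefB -coefN -DS mulrBl mul1r.
elim: N => [|N IHN].
  by have := DSi 0; rewrite !coefXM /= subr0 big_geq.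
have := DSi N.+1; rewrite !coefXM /= IHN big_nat_recr //= => /eqP.
by rewrite subr_eq => /eqP ->; ring.
Qed.

Lemma l1norm_sum (Q : nat) (I : Type) (s : seq I) (P : pred I) (F : I -> {poly K}) :
  l1norm Q (\sum_(i <- s | P i) F i) <= \sum_(i <- s | P i) l1norm Q (F i).
Proof.
rewrite /l1norm exchange_big; apply: ler_sum => i _.
by rewrite coef_sum ler_norm_sum.
Qed.

Lemma l1normZ (Q : nat) (a : K) (f : {poly K}) : l1norm Q (a *: f) = `|a| * l1norm Q f.
Proof. by rewrite /l1norm mulr_sumr; apply: eq_bigr => i _; rewrite coefZ normrM. Qed.

Lemma l1normB (Q : nat) (f g : {poly K}) : l1norm Q (f - g) <= l1norm Q f + l1norm Q g.
Proof.
by rewrite /l1norm -big_split; apply: ler_sum => i _; rewrite coefB ler_normB.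
Qed.

Lemma l1normMXn (Q a : nat) (f : {poly K}) : l1norm Q (f * 'X^a) <= l1norm Q f.
Proof.
elim: a => [|a IHa]; first by rewrite mulr1.
apply: le_trans IHa; rewrite exprSr mulrA; move: (f * 'X^a) => {}f.
rewrite /l1norm; case: Q => [|Q]; first by rewrite !big_geq.
rewrite big_nat_recl // coefMX /= normr0 add0r [leRHS]big_nat_recr //=.
by rewrite (eq_bigr (fun i => `|f`_i|)) ?lerDl // => i _; rewrite coefMX.
Qed.

(** The product has no coefficients below a, and from there on 1 / (i + 1) is at most 1 / (a +
    1). *)
Lemma weighted_coefMXn (Q a : nat) (f : {poly K}) :
  \sum_(0 <= i < Q) `|(f * 'X^a)`_i| / i.+1%:R <= l1norm Q f / a.+1%:R.
Proof.
apply: (@le_trans _ _ (l1norm Q (f * 'X^a) / a.+1%:R)); last first.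
  by rewrite ler_pM2r ?invr_gt0 ?ltr0n // l1normMXn.
rewrite /l1norm mulr_suml; apply: ler_sum => i _; rewrite coefMXn.
case: ltnP => ai; first by rewrite normr0 !mul0r.
by apply: ler_wpM2l => //; rewrite lef_pV2 ?posrE ?ltr0n // ler_nat.
Qed.

Lemma harmonic_sum_ge0 (P : nat) : 0 <= H P.
Proof. by apply: sumr_ge0 => i _; rewrite invr_ge0 ler0n. Qed.

Lemma harmonic_sum_ge1 (P : nat) : (0 < P)%N -> 1 <= H P.
Proof.
move=> P_gt0; rewrite /harmonic_sum big_ltn // invr1 lerDl.
by apply: sumr_ge0 => i _; rewrite invr_ge0 ler0n.
Qed.

Lemma harmonic_sum_prefix (p P : nat) : (p <= P.+1)%N ->
  \sum_(1 <= i < p) i%:R^-1 <= H P.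
Proof.
case: p => [|p] pP; first by rewrite big_geq // harmonic_sum_ge0.
rewrite /harmonic_sum [leRHS](@big_cat_nat _ _ _ p.+1) //= lerDl.
by apply: sumr_ge0 => i _; rewrite invr_ge0 ler0n.
Qed.

(** Each level of the recursion costs a factor 2 from 1 - 'X^(p - q) and, beyond the first level, a
    factor H_P from the sum of the 1 / q. *)
Lemma l1norm_front (Q P j p : nat) : (p <= P)%N ->
  l1norm Q (front j.+1 p) <= 2 ^+ j.+1 * H P ^+ j / p%:R.
Proof.
have step i q : l1norm Q (front i.+1 q) <=
    q%:R^-1 * \sum_(0 <= r < q) 2 * l1norm Q (front i r).
  rewrite frontS l1normZ ger0_norm ?invr_ge0 ?ler0n //.
  apply: ler_wpM2l; rewrite ?invr_ge0 ?ler0n //.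
  apply: le_trans (l1norm_sum _ _ _ _ _) _; apply: ler_sum => r _.
  rewrite mulrBr mulr1; apply: le_trans (l1normB _ _ _) _.
  by rewrite mulr_natl mulr2n lerD2l l1normMXn.
elim: j p => [|j IHj] p pP; apply: le_trans (step _ _) _.
  rewrite mulrC ler_wpM2r ?invr_ge0 ?ler0n // !expr0 expr1 mulr1.
  case: p {pP} => [|p]; first by rewrite big_geq.
  rewrite /front big_nat_recl //= big1 ?addr0 => [|i _]; last first.
    by rewrite /l1norm big1 ?mulr0 // => r _; rewrite coef0 normr0.
  rewrite ler_piMr // /l1norm; case: Q {step} => [|Q]; first by rewrite big_geq.
  rewrite big_nat_recl //= coef1 normr1 big1 ?addr0 // => i _.
  by rewrite coef1 normr0.
rewrite mulrC ler_wpM2r ?invr_ge0 ?ler0n //.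
case: p pP => [|p] pP.
  by rewrite big_geq // mulr_ge0 ?exprn_ge0 ?harmonic_sum_ge0.
rewrite big_ltn // front0 {1}/l1norm big1 ?mulr0 ?add0r => [|i _]; last first.
  by rewrite coef0 normr0.
apply: (@le_trans _ _ (\sum_(1 <= r < p.+1) 2 * (2 ^+ j.+1 * H P ^+ j / r%:R))).
  rewrite big_nat [leRHS]big_nat; apply: ler_sum => r /andP[_ rp].
  by rewrite ler_wpM2l // IHj //; lia.
rewrite (eq_bigr (fun r => 2 ^+ j.+2 * H P ^+ j * r%:R^-1)) => [|r _]; last first.
  by rewrite [2 ^+ j.+2]exprS !mulrA.
rewrite -mulr_sumr [H P ^+ j.+1]exprSr mulrA.
rewrite ler_wpM2l ?harmonic_sum_prefix //; last by lia.
by rewrite mulr_ge0 ?exprn_ge0 ?harmonic_sum_ge0.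
Qed.

(** Partial fractions, with q + (P - q + 1) = P + 1; the two halves are reflections of each
    other. *)
Lemma sum_inv_conv (P : nat) :
  \sum_(1 <= q < P.+1) (q%:R * (P - q).+1%:R)^-1 = 2 * H P / P.+1%:R :> K.
Proof.
rewrite mulr_natl mulr2n {1}/harmonic_sum [X in X + _]big_nat_rev /= -big_split mulr_suml.
apply: eq_big_nat => q /andP[q_gt0 qP] /=.
have -> : (1 + P.+1 - q.+1 = (P - q).+1)%N by lia.
have -> : P.+1%:R = q%:R + (P - q).+1%:R :> K by rewrite -natrD; congr (_%:R); lia.
have q_neq0 : q%:R != 0 :> K by rewrite pnatr_eq0 -lt0n.
have r_neq0 : (P - q).+1%:R != 0 :> K by rewrite pnatr_eq0.
have s_neq0 : q%:R + (P - q).+1%:R != 0 :> K by rewrite -natrD pnatr_eq0 addnS.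
by move: q_neq0 r_neq0 s_neq0; move: (q%:R) (_.+1%:R) => x y *; field; apply/and3P.
Qed.

(** 1 / N^2 is at most 2 / (N (N + 1)), which telescopes. *)
Lemma sum_inv_sqr_tail (a b : nat) :
  (0 < a)%N -> \sum_(a <= N < b) (N%:R ^+ 2)^-1 <= 2 / a%:R :> K.
Proof.
move=> a_gt0; case: (leqP b a) => [ba|ab].
  by rewrite big_geq // divr_ge0 ?ler0n.
apply: (@le_trans _ _ (\sum_(a <= N < b) (2 * ((- N.+1%:R^-1) - (- N%:R^-1))))).
  rewrite big_nat [leRHS]big_nat; apply: ler_sum => N /andP[aN _].
  have N_gt0 : 0 < N%:R :> K by rewrite ltr0n; lia.
  have -> : 2 * (- N.+1%:R^-1 - - N%:R^-1) = 2 / (N%:R * N.+1%:R) :> K.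
    rewrite -natr1; field.
    by rewrite (gt_eqF N_gt0) andbT addrC natr1 pnatr_eq0.
  rewrite -[leLHS]mul1r ler_pdivrMr ?exprn_gt0 // mulrAC ler_pdivlMr; last first.
    by rewrite mulr_gt0 // ltr0n.
  rewrite mul1r expr2 mulrCA ler_pM2l // -natrM ler_nat; lia.
rewrite -mulr_sumr telescope_sumr 1?ltnW // opprK addrC ler_wpM2l //.
by rewrite lerBlDr lerDl invr_ge0 ler0n.
Qed.

(** By [defectE] the coefficients are, up to sign, prefix sums of those of [remainder]. Exchanging
    the sums leaves tails of 1 / N^2, at most 2 / (i + 1); then [l1norm_front] and [sum_inv_conv]
    finish. The exponent j + 3 is 1 from the tails, j + 1 from [l1norm_front] and 1 from the
    convolution. *)
Lemma defect_bound (j P : nat) :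
  \sum_(1 <= N < P.+1) `|(defect j P)`_N| / N%:R ^+ 2 <=
  2 ^+ j.+3 * H P ^+ j.+1 / P.+1%:R.
Proof.
apply: (@le_trans _ _ (\sum_(0 <= i < P.+1) 2 * (`|(remainder j P)`_i| / i.+1%:R))).
  apply: (@le_trans _ _ (\sum_(0 <= N < P.+1) \sum_(0 <= i < N)
      `|(remainder j P)`_i| / N%:R ^+ 2)).
    rewrite [leRHS]big_ltn // [X in X + _]big_geq // add0r.
    apply: ler_sum => N _; rewrite -mulr_suml ler_wpM2r ?invr_ge0 ?exprn_ge0 //.
    by rewrite (coef_telescope _ _ _ (defectE j P)) normrN ler_norm_sum.
  rewrite sum_triangle; apply: ler_sum => i _.
  by rewrite -mulr_sumr mulrCA ler_wpM2l // sum_inv_sqr_tail.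
rewrite -mulr_sumr [2 ^+ j.+3]exprS -2!mulrA ler_wpM2l //.
apply: (@le_trans _ _ (\sum_(0 <= q < P.+1) l1norm P.+1 (front j.+1 q) / (P - q).+1%:R)).
  apply: (@le_trans _ _ (\sum_(0 <= i < P.+1) \sum_(0 <= q < P.+1)
      `|(front j.+1 q * 'X^(P - q))`_i| / i.+1%:R)).
    apply: ler_sum => i _; rewrite -mulr_suml ler_wpM2r ?invr_ge0 ?ler0n //.
    by rewrite /remainder coef_sum ler_norm_sum.
  by rewrite exchange_big; apply: ler_sum => q _; rewrite weighted_coefMXn.
rewrite big_ltn // front0 {1}/l1norm big1 ?mul0r ?add0r => [|i _]; last first.
  by rewrite coef0 normr0.
apply: (@le_trans _ _ (\sum_(1 <= q < P.+1)
    2 ^+ j.+1 * H P ^+ j * (q%:R * (P - q).+1%:R)^-1)).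
  rewrite big_nat [leRHS]big_nat; apply: ler_sum => q /andP[_ qP].
  by rewrite invfM mulrA ler_wpM2r ?invr_ge0 ?ler0n // l1norm_front.
rewrite -mulr_sumr sum_inv_conv [2 ^+ j.+2]exprSr [H P ^+ j.+1]exprSr.
by rewrite le_eqVlt; apply/orP; left; apply/eqP; rewrite !mulrA; congr (_ / _); ring.
Qed.

Lemma coef_sum_back0 (P N : nat) : (0 < N <= P)%N -> coef_sum_back 0 P N = N%:R^-1.
Proof.
move=> /andP[N_gt0 NP]; rewrite /coef_sum_back.
rewrite (@eq_big_nat _ _ _ _ _ _ (fun p => if p == N then N%:R^-1 else 0)); last first.
  move=> [|p] // _; rewrite back0 coefXn eq_sym.
  by case: eqP => [->|_]; rewrite ?mul1r ?mul0r.
by rewrite -big_mkcond big_nat1_eq N_gt0 ltnS NP.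
Qed.

(** The error for j + 1 is the error for j plus the defect, divided by N. This division is given
    away on the old error and kept on the defect, where it yields the weight 1 / N^2 of
    [defect_bound]. The factor j counts the defects, each bounded by the last and largest bound, as
    H_P >= 1. *)
Lemma coef_sum_back_bound (j P : nat) : (0 < P)%N ->
  \sum_(1 <= N < P.+1) `|coef_sum_back j P N - (N%:R ^+ j.+1)^-1| / N%:R <=
  j%:R * 2 ^+ j.+2 * H P ^+ j / P.+1%:R.
Proof.
move=> P_gt0; elim: j => [|j IHj].
  rewrite !mul0r big_nat big1 // => N /andP[N_gt0 NP].
  by rewrite coef_sum_back0 ?N_gt0 // subrr normr0 mul0r.
apply: (@le_trans _ _ (\sum_(1 <= N < P.+1)
   (`|coef_sum_back j P N - (N%:R ^+ j.+1)^-1| / N%:R +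
    `|(defect j P)`_N| / N%:R ^+ 2))).
  rewrite big_nat [leRHS]big_nat; apply: ler_sum => N /andP[N_gt0 _].
  have N_pos : 0 < N%:R :> K by rewrite ltr0n.
  have N_neq0 : N%:R != 0 :> K by rewrite gt_eqF.
  have -> : coef_sum_back j.+1 P N - (N%:R ^+ j.+2)^-1 =
     ((coef_sum_back j P N - (N%:R ^+ j.+1)^-1) + (defect j P)`_N) / N%:R.
    rewrite addrAC -coef_sum_back_step mulrBl mulrAC mulfV // mul1r.
    by rewrite [_ ^+ j.+2]exprSr invfM.
  rewrite normrM normfV (ger0_norm (ltW N_pos)) -mulrA -invfM -expr2.
  apply: (@le_trans _ _ ((`|coef_sum_back j P N - (N%:R ^+ j.+1)^-1| +
      `|(defect j P)`_N|) / N%:R ^+ 2)).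
    by rewrite ler_wpM2r ?invr_ge0 ?exprn_ge0 ?(ltW N_pos) // ler_normD.
  rewrite mulrDl lerD2r ler_wpM2l // lef_pV2 ?posrE ?exprn_gt0 //.
  by rewrite -natrX ler_nat; case: N N_gt0 {N_pos N_neq0} => // N _; lia.
rewrite big_split /=; apply: le_trans (lerD IHj (defect_bound j P)) _.
rewrite -mulrDl ler_wpM2r ?invr_ge0 ?ler0n //.
rewrite -[j.+1%:R]natr1 mulrDl mul1r mulrDl lerD2r.
rewrite -[leLHS]mulrA -[leRHS]mulrA ler_wpM2l ?ler0n //.
rewrite ler_pM ?exprn_ge0 ?harmonic_sum_ge0 //.
  by rewrite ler_weXn2l // ler1n.
by rewrite ler_weXn2l // harmonic_sum_ge1.
Qed.
End Estimate.

(** * Nested sums over compositions *)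

(* The parts are listed from the last to the first, so that peeling off the
   head removes the last part m_n (or the last exponent k_n). *)
Fixpoint compositions (n p : nat) : seq (seq nat) :=
  if n is i.+1 then
    flatten [seq [seq (p - q)%N :: s | s <- compositions i q] | q <- iota 0 p]
  else if p is 0 then [:: [::]] else [::].

Lemma mem_compositions (n p : nat) (s : seq nat) :
  (s \in compositions n p) = [&& size s == n, all (leq 1) s & sumn s == p].
Proof.
elim: n p s => [|n IHn] p s.
  by case: p s => [|p] [|a s].
apply/flatten_mapP/idP => [[q]|].
  rewrite mem_iota add0n => /andP[_ qp] /mapP[s' + ->].
  rewrite IHn => /and3P[/eqP /= -> -> /eqP ->].
  by rewrite eqxx subn_gt0 qp subnK ?eqxx // ltnW.
case: s => [|a s] //= /and3P[size_s /andP[a_gt0 s_gt0] /eqP <-].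
exists (sumn s); first by rewrite mem_iota; lia.
by apply/mapP; exists s; rewrite ?IHn ?addnK //; apply/and3P.
Qed.

Lemma uniq_compositions (n p : nat) : uniq (compositions n p).
Proof.
elim: n p => [|n IHn] p; first by case: p.
apply: (@allpairs_uniq_dep _ (fun=> seq nat)) => [|q _|]; rewrite ?iota_uniq //.
move=> _ _ /allpairsPdep[q [s [qp _ ->]]] /allpairsPdep[r [s' [rp _ ->]]] /=.
move: qp rp; rewrite !mem_iota => qp rp [qr ->].
by rewrite (_ : q = r) //; lia.
Qed.

Lemma sum_compositions (V : nmodType) (n p : nat) (f : seq nat -> V) :
  \sum_(s <- compositions n.+1 p) f s =
  \sum_(0 <= q < p) \sum_(s <- compositions n q) f ((p - q)%N :: s).
Proof.
rewrite big_flatten big_map /index_iota subn0.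
by apply: eq_bigr => q _; rewrite big_map.
Qed.

(** As the parts come last first, [sumn s] adds the part at the head to all earlier ones, so it is a
    p_j. *)
Fixpoint denom (K : numFieldType) (s c : seq nat) : K :=
  match s, c with
  | a :: s', b :: c' => (sumn s)%:R ^+ b * denom K s' c'
  | _, _ => 1
  end.

(* With r the first index such that k_r <> 1, or n if there is none, this is
   1 - (1 - t ^ m_1) ... (1 - t ^ m_r), telescoped. *)
Fixpoint numer (K : numFieldType) (t : K) (s c : seq nat) : K :=
  match s, c with
  | a :: s', b :: c' =>
      numer K t s' c' + (all (pred1 1%N) c')%:R * (t ^+ a * \prod_(x <- s') (1 - t ^+ x))
  | _, _ => 0
  end.

Section NestedSums.
Variables (K : numFieldType) (t : K).
Local Notation front := (front K).
Local Notation back := (back K).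
Local Notation numer := (numer K t).
Local Notation denom := (denom K).

(** The last exponent may be 1 here, because the recursion meets inner exponents without
    restriction. *)
Definition nested_sum (n w p : nat) : K :=
  \sum_(c <- compositions n w) \sum_(s <- compositions n p) numer s c / denom s c.

Lemma horner_front (n p : nat) : (front n p).[t] =
  \sum_(s <- compositions n p) (\prod_(x <- s) (1 - t ^+ x)) / denom s (nseq n 1%N).
Proof.
elim: n p => [|n IHn] p.
  rewrite /front; case: p => [|p] /=; last by rewrite big_nil horner0.
  by rewrite big_seq1 big_nil divr1 hornerC.
rewrite frontS hornerZ horner_sum sum_compositions mulr_sumr.
apply: eq_big_nat => q /andP[_ qp].
rewrite hornerM IHn mulr_suml mulr_sumr [LHS]big_seq [RHS]big_seq.
apply: eq_bigr => s; rewrite mem_compositions => /and3P[_ _ /eqP sq].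
rewrite big_cons /= sq subnK 1?ltnW // expr1 invfM hornerD hornerN hornerXn (hornerC 1).
by ring.
Qed.

Lemma horner_back_sum (n p : nat) : (back n p).[t] =
  \sum_(0 <= q < p) \sum_(s <- compositions n q)
    t ^+ (p - q) * (\prod_(x <- s) (1 - t ^+ x)) / denom s (nseq n 1%N).
Proof.
rewrite /back horner_sum; apply: eq_bigr => q _.
rewrite hornerM horner_front hornerXn mulrC mulr_sumr.
by apply: eq_bigr => s _; rewrite mulrA.
Qed.

Lemma sum_all_ones (n w : nat) (g : seq nat -> K) :
  \sum_(c <- compositions n w) (all (pred1 1%N) c)%:R * g c =
  (w == n)%:R * g (nseq n 1%N).
Proof.
elim: n w g => [|n IHn] w g.
  case: w => [|w]; rewrite /= ?big_nil ?mul0r //.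
  by rewrite big_seq1.
rewrite sum_compositions.
rewrite (@eq_big_nat _ _ _ _ _ _ 
  (fun q => if q == n then (w == n.+1)%:R * g (nseq n.+1 1%N) else 0)).
  rewrite -big_mkcond big_nat1_eq /=; case: ltnP => // wn.
  by case: eqP wn => [->|]; rewrite ?ltnn // mul0r.
move=> q /andP[_ qw].
rewrite (eq_bigr (fun c =>
  (all (pred1 1%N) c)%:R * (((w - q)%N == 1%N)%:R * g ((w - q)%N :: c)))).
  rewrite IHn; case: eqP => [->|]; last by rewrite mul0r.
  rewrite mul1r (_ : ((w - n)%N == 1%N) = (w == n.+1)); last by lia.
  by case: eqP => [->|]; rewrite ?mul0r // subSn // subnn.
by move=> c _ /=; case: eqP => _ /=; rewrite ?mul1r // mul0r mulr0.
Qed.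

(** The last part p - q and the last exponent w - v are split off. The new term of [numer] survives
    only if the other exponents are all 1, which forces v = n, and then it sums to B_n(p) at t. The
    predicate [h] serves both for k_n >= 2 and for no condition at all. *)
Lemma nested_sum_rec (h : pred nat) (n w p : nat) :
  \sum_(c <- compositions n.+1 w | h (head 0%N c))
    \sum_(s <- compositions n.+1 p) numer s c / denom s c =
  \sum_(0 <= v < w | h (w - v)%N)
    (\sum_(0 <= q < p) nested_sum n v q + (v == n)%:R * (back n p).[t]) / p%:R ^+ (w - v).
Proof.
rewrite big_mkcond sum_compositions [RHS]big_mkcond.
apply: eq_big_nat => v /andP[_ vw] /=.
case: ifP => _; last by rewrite big1.
transitivity (\sum_(c <- compositions n v) \sum_(0 <= q < p) \sum_(s <- compositions n q)
   (numer s c / denom s c + (all (pred1 1%N) c)%:R *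
      (t ^+ (p - q) * (\prod_(x <- s) (1 - t ^+ x)) / denom s c)) / p%:R ^+ (w - v)).
  apply: eq_bigr => c _; rewrite sum_compositions; apply: eq_big_nat => q /andP[_ qp].
  rewrite [LHS]big_seq [RHS]big_seq; apply: eq_bigr => s.
  rewrite mem_compositions => /and3P[_ _ /eqP sq] /=.
  by rewrite sq subnK 1?ltnW // invfM; ring.
rewrite mulrDl /nested_sum [in RHS]exchange_big horner_back_sum.
rewrite -(sum_all_ones n v (fun c => \sum_(0 <= q < p) \sum_(s <- compositions n q)
  t ^+ (p - q) * (\prod_(x <- s) (1 - t ^+ x)) / denom s c)).
rewrite !mulr_suml -big_split; apply: eq_bigr => c _ /=.
rewrite mulr_sumr !mulr_suml -big_split; apply: eq_bigr => q _ /=.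
rewrite mulr_sumr !mulr_suml -big_split; apply: eq_bigr => s _ /=.
by rewrite mulrDl.
Qed.

Lemma geometric_telescope (x y : K) (d : nat) : x != 0 -> y != 0 ->
  \sum_(0 <= v < d) (x - y) / (x ^+ (d - v) * y ^+ v.+1) = y ^- d - x ^- d.
Proof.
move=> x_neq0 y_neq0; elim: d => [|d IHd]; first by rewrite big_geq // subrr.
rewrite big_nat_recr //= subSn // subnn expr1.
rewrite (@eq_big_nat _ _ _ _ _ _ 
  (fun v => x^-1 * ((x - y) / (x ^+ (d - v) * y ^+ v.+1)))).
  rewrite -mulr_sumr IHd !exprS; field.
  by rewrite !expf_neq0 // x_neq0 y_neq0.
move=> v /andP[_ vd]; rewrite subSn 1?ltnW // exprS !invfM; ring.
Qed.

Lemma nested_sum0 (w p : nat) : nested_sum 0 w p = 0.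
Proof.
rewrite /nested_sum; case: w => [|w] /=; last by rewrite big_nil.
by rewrite big_seq1 big1 // => -[|a s] _; rewrite mul0r.
Qed.

(** The source of the collapse, used with x = p and y = N. The first summands form a geometric sum
    of value y^-(w - n) - x^-(w - n), and the summand with v = n supplies the missing x^-(w - n). *)
Lemma sum_powers_weights (x y : K) (n w : nat) : x != 0 -> y != 0 ->
  \sum_(0 <= v < w)
    ((n <= v)%:R * ((x - y) / y ^+ (v - n).+1) + (v == n)%:R) / x ^+ (w - v) =
  (n < w)%:R / y ^+ (w - n).
Proof.
move=> x_neq0 y_neq0; case: ltnP => [nw|wn]; last first.
  rewrite mul0r big_nat big1 // => v /andP[_ vw].
  by rewrite leqNgt (leq_trans vw wn) ltn_eqF ?(leq_trans vw wn) // mul0r addr0 mul0r.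
rewrite (@big_cat_nat _ _ _ n) //= 1?ltnW //.
rewrite big_nat big1 ?add0r => [|v /andP[_ vn]]; last first.
  by rewrite leqNgt vn ltn_eqF // mul0r addr0 mul0r.
rewrite -{1}[n]add0n big_addn mul1r.
rewrite (@eq_big_nat _ _ _ _ _ _ (fun i => (x - y) / (x ^+ (w - n - i) * y ^+ i.+1) +
    if i == 0%N then x ^- (w - n) else 0)); last first.
  move=> i /andP[_ iw]; rewrite leq_addl mul1r addnK -{2}[n]add0n eqn_add2r.
  rewrite (_ : (w - (i + n) = w - n - i)%N); last by lia.
  rewrite mulrDl invfM [in RHS]mulrA mulrAC; congr (_ + _).
  by case: eqP => [->|_]; rewrite ?mul1r ?subn0 // mul0r.
rewrite big_split /= geometric_telescope // -big_mkcond big_nat1_eq subn_gt0 nw.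
by rewrite subrK.
Qed.

Lemma nested_sum_at0 (n w : nat) : nested_sum n.+1 w 0 = 0.
Proof. by rewrite /nested_sum big1 // => c _; rewrite big_nil. Qed.

(** The step shared by the base case and the induction in [nested_sumE]; its hypothesis has the form
    that [back0_coef_step] and [back_coef_step] provide. *)
Lemma nested_sum_close (n w x Q : nat) :
  (x.+1 < Q)%N ->
  (forall v, \sum_(0 <= q < x.+1) nested_sum n v q =
    \sum_(1 <= N < Q) (back n x.+1)`_N * t ^+ N *
      ((n <= v)%:R * ((x.+1%:R - N%:R) / N%:R ^+ (v - n).+1))) ->
  nested_sum n.+1 w x.+1 =
  (n < w)%:R * \sum_(1 <= N < Q) (back n x.+1)`_N * t ^+ N / N%:R ^+ (w - n).
Proof.
move=> xQ prev; rewrite [LHS](nested_sum_rec predT).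
transitivity (\sum_(0 <= v < w) \sum_(1 <= N < Q) (back n x.+1)`_N * t ^+ N *
    (((n <= v)%:R * ((x.+1%:R - N%:R) / N%:R ^+ (v - n).+1) + (v == n)%:R) /
      x.+1%:R ^+ (w - v))).
  apply: eq_bigr => v _; rewrite prev (horner_back _ _ _ _ _ xQ) mulr_sumr.
  by rewrite -big_split mulr_suml; apply: eq_bigr => N _ /=; ring.
rewrite exchange_big mulr_sumr; apply: eq_big_nat => N /andP[N_gt0 _].
rewrite -mulr_sumr sum_powers_weights ?pnatr_eq0 -?lt0n //.
by ring.
Qed.

(** In the induction, [back_coef_step] turns the sum over q < p of the earlier coefficients into p -
    N times the new one, the shape needed for [sum_powers_weights]. *)
Lemma nested_sumE (n w p Q : nat) : (p < Q)%N ->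
  nested_sum n.+1 w p =
  (n < w)%:R * \sum_(1 <= N < Q) (back n p)`_N * t ^+ N / N%:R ^+ (w - n).
Proof.
elim: n w p => [|n IHn] w [|x] xQ; try by
  rewrite nested_sum_at0 back_at0 big1 ?mulr0 // => N _; rewrite coef0 !mul0r.
all: apply: nested_sum_close => // v.
  (* Both sides vanish: there is no nested sum of depth 0, and [back 0 p] has a coefficient only at
     N = p. *)
  rewrite !big1 // => [N _|q _]; last exact: nested_sum0.
  transitivity ((x.+1%:R - N%:R) * (back 0 x.+1)`_N *
    (t ^+ N * (0 <= v)%:R / N%:R ^+ (v - 0).+1)); first by ring.
  by rewrite back0_coef_step mul0r.
rewrite (@eq_big_nat _ _ _ _ _ _ (fun q => (n < v)%:R *
    \sum_(1 <= N < Q) (back n q)`_N * t ^+ N / N%:R ^+ (v - n))); last first.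
  by move=> q /andP[_ qx]; apply: IHn; lia.
rewrite -mulr_sumr exchange_big mulr_sumr; apply: eq_bigr => N _ /=.
rewrite -!mulr_suml back_coef_step; case: ltnP => nv; last by rewrite !mul0r mulr0.
by rewrite subnSK //; ring.
Qed.

(* The sum over all admissible exponents k_1, ..., k_(n+1) of total weight k,
   cut off at m_1 + ... + m_(n+1) <= P. *)
Definition truncated_sum (n k P : nat) : K :=
  \sum_(1 <= p < P.+1)
    \sum_(c <- compositions n.+1 k | (1 < head 0 c)%N)
      \sum_(s <- compositions n.+1 p) numer s c / denom s c.

(** Lowering the last exponent by 1 turns k_n >= 2 into no condition and takes out a factor 1 / p,
    so what remains is [nested_sum] of weight k - 1. *)
Lemma truncated_sumE (n k P : nat) : (n.+1 < k)%N ->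
  truncated_sum n k P =
  \sum_(1 <= N < P.+1) t ^+ N / N%:R ^+ (k - n.+1) * coef_sum_back K n P N.
Proof.
case: k => // k nk; rewrite /truncated_sum.
transitivity (\sum_(1 <= p < P.+1) \sum_(1 <= N < P.+1)
    t ^+ N / N%:R ^+ (k - n) * ((back n p)`_N / p%:R)).
  apply: eq_big_nat => p /andP[p_gt0 pP].
  rewrite (nested_sum_rec (fun b => 1 < b)%N) big_mkcond big_nat_recr //=.
  rewrite subSn // subnn addr0.
  transitivity (nested_sum n.+1 k p / p%:R).
    rewrite [nested_sum _ _ _](nested_sum_rec predT) mulr_suml.
    apply: eq_big_nat => v /andP[_ vk]; rewrite (_ : (1 < k.+1 - v)%N); last by lia.
    by rewrite subSn 1?ltnW // exprSr invfM mulrA.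
  rewrite (nested_sumE _ _ _ _ pP) (_ : (n < k)%N) // mul1r mulr_suml.
  by apply: eq_bigr => N _; ring.
rewrite exchange_big; apply: eq_bigr => N _ /=.
by rewrite /coef_sum_back -mulr_sumr.
Qed.

(** Since k > n + 1, the modulus of t^N / N^(k - n - 1) is at most 1 / N, the weight in
    [coef_sum_back_bound]. *)
Lemma truncated_sum_bound (n k P : nat) : (n.+1 < k)%N -> `|t| <= 1 -> (0 < P)%N ->
  `|truncated_sum n k P - \sum_(1 <= N < P.+1) t ^+ N / N%:R ^+ k| <=
  n%:R * 2 ^+ n.+2 * harmonic_sum K P ^+ n / P.+1%:R.
Proof.
move=> nk t_le1 P_gt0; apply: le_trans (coef_sum_back_bound K n P P_gt0).
rewrite truncated_sumE // -sumrB; apply: le_trans (ler_norm_sum _ _ _) _.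
rewrite big_nat [leRHS]big_nat; apply: ler_sum => N /andP[N_gt0 _].
have N_pos : 0 < N%:R :> K by rewrite ltr0n.
have -> : t ^+ N / N%:R ^+ k = t ^+ N / N%:R ^+ (k - n.+1) * (N%:R ^+ n.+1)^-1.
  by rewrite -mulrA -invfM -exprD subnK // ltnW.
rewrite -mulrBr normrM mulrC ler_wpM2l //.
rewrite normrM normfV normrX normrX (ger0_norm (ltW N_pos)).
apply: (@le_trans _ _ (1 / N%:R ^+ (k - n.+1))).
  by rewrite ler_wpM2r ?invr_ge0 ?exprn_ge0 ?(ltW N_pos) // exprn_ile1.
rewrite mul1r lef_pV2 ?posrE ?exprn_gt0 // -natrX ler_nat.
by rewrite -{1}[N]expn1 leq_pexp2l // subn_gt0.
Qed.
End NestedSums.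

(** * Absolute convergence *)

Section AbsoluteBound.
Variables (K : numFieldType) (t : K).
Hypothesis t_le1 : `|t| <= 1.
Local Notation numer := (numer K t).
Local Notation denom := (denom K).

Lemma norm_prod_one_sub (s : seq nat) :
  `|\prod_(x <- s) (1 - t ^+ x)| <= 2 ^+ size s.
Proof.
elim: s => [|a s IHs]; first by rewrite big_nil normr1.
rewrite big_cons normrM exprS ler_pM //.
by apply: le_trans (ler_normB _ _) _; rewrite normr1 normrX lerD2l exprn_ile1.
Qed.

Lemma norm_numer (s c : seq nat) : `|numer s c| <= 2 ^+ size s.
Proof.
elim: s c => [|a s IHs] [|b c] /=; rewrite ?normr0 ?exprn_ge0 //.
apply: le_trans (ler_normD _ _) _; rewrite exprS [leRHS]mulr_natl mulr2n lerD //.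
rewrite !normrM normrX; case: (all _ c); rewrite ?normr0 ?mul0r ?exprn_ge0 //.
rewrite normr1 mul1r -[leRHS]mul1r ler_pM ?exprn_ge0 ?norm_prod_one_sub //.
exact: exprn_ile1.
Qed.

Lemma denom_gt0 (s c : seq nat) : all (leq 1) s -> 0 < denom s c.
Proof.
elim: s c => [|a s IHs] [|b c] //= /andP[a_gt0 /IHs s_gt0].
by rewrite mulr_gt0 // exprn_gt0 // ltr0n addn_gt0 a_gt0.
Qed.

Lemma denom_ones_le (s c : seq nat) : all (leq 1) s -> all (leq 1) c ->
  denom s (nseq (size c) 1%N) <= denom s c.
Proof.
elim: s c => [|a s IHs] [|b c] //= /andP[a_gt0 s_gt0] /andP[b_gt0 c_gt0].
rewrite ler_pM ?exprn_ge0 ?ler0n ?IHs // ?(ltW (denom_gt0 _ _ s_gt0)) //.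
by rewrite ler_weXn2l // ler1n addn_gt0 a_gt0.
Qed.

(** The condition k_n >= 2 leaves a spare factor p once all exponents are lowered to 1. *)
Lemma denom_admissible_le (s c : seq nat) :
  all (leq 1) s -> all (leq 1) c -> (1 < head 0%N c)%N ->
  (sumn s)%:R * denom s (nseq (size c) 1%N) <= denom s c.
Proof.
case: s c => [|a s] [|b c] //=.
move=> /andP[a_gt0 s_gt0] /andP[_ c_gt0] b_gt1.
rewrite mulrA -exprS ler_pM ?exprn_ge0 ?ler0n ?denom_ones_le //.
  by rewrite ltW // denom_gt0.
by rewrite ler_weXn2l // ler1n addn_gt0 a_gt0.
Qed.

Definition unit_sum (n p : nat) : K :=
  \sum_(s <- compositions n p) (denom s (nseq n 1%N))^-1.

Lemma unit_sum_ge0 (n p : nat) : 0 <= unit_sum n p.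
Proof.
rewrite /unit_sum big_seq; apply: sumr_ge0 => s.
rewrite mem_compositions => /and3P[_ s_gt0 _].
by rewrite invr_ge0 ltW // denom_gt0.
Qed.

Lemma unit_sum_rec (n p : nat) :
  unit_sum n.+1 p = p%:R^-1 * \sum_(0 <= q < p) unit_sum n q.
Proof.
rewrite /unit_sum sum_compositions mulr_sumr; apply: eq_big_nat => q /andP[_ qp].
rewrite mulr_sumr [LHS]big_seq [RHS]big_seq; apply: eq_bigr => s.
rewrite mem_compositions => /and3P[_ _ /eqP sq] /=.
by rewrite sq subnK 1?ltnW // invfM expr1.
Qed.

(** After exchanging the sums, the tail of 1 / p^2 beyond q is at most 2 / q, which reproduces the
    sum with one variable less; each variable costs a factor 2. *)
Lemma unit_sum_bound (n P : nat) :
  \sum_(1 <= p < P.+1) unit_sum n.+1 p / p%:R <= 2 ^+ n.+1.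
Proof.
elim: n => [|n IHn].
  apply: (@le_trans _ _ (\sum_(1 <= p < P.+1) (p%:R ^+ 2)^-1)); last first.
    by have := sum_inv_sqr_tail K 1 P.+1 isT; rewrite divr1.
  rewrite big_nat [leRHS]big_nat; apply: ler_sum => -[|p] // _.
  rewrite unit_sum_rec big_nat_recl // /unit_sum /= big_seq1 /= invr1.
  rewrite big1 ?addr0 ?mulr1; last by move=> i _; rewrite big_nil.
  by rewrite expr2 invfM.
rewrite exprS; apply: le_trans (ler_wpM2l _ IHn) => //.
apply: (@le_trans _ _ (\sum_(0 <= p < P.+1) \sum_(0 <= q < p)
    unit_sum n.+1 q * (p%:R ^+ 2)^-1)).
  rewrite [leRHS]big_ltn // [X in X + _]big_geq // add0r.
  apply: ler_sum => p _; rewrite unit_sum_rec -mulr_suml.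
  by rewrite mulrAC mulrC expr2 invfM.
rewrite sum_triangle big_ltn // [X in X + _]big1 ?add0r => [|p _]; last first.
  by rewrite /unit_sum big_nil mul0r.
rewrite mulr_sumr big_nat [leRHS]big_nat; apply: ler_sum => q /andP[q_gt0 _].
rewrite -mulr_sumr mulrCA ler_wpM2l ?unit_sum_ge0 //.
apply: le_trans (sum_inv_sqr_tail K q.+1 P.+1 isT) _.
by rewrite ler_wpM2l // lef_pV2 ?posrE ?ltr0n // ler_nat.
Qed.

(** One factor 2^(n + 1) bounds the numerators and the other is [unit_sum_bound], whose division by
    p comes from [denom_admissible_le]. *)
Lemma absolute_bound (n k P : nat) (c : seq nat) :
  c \in compositions n.+1 k -> (1 < head 0%N c)%N ->
  \sum_(1 <= p < P.+1) \sum_(s <- compositions n.+1 p) `|numer s c / denom s c| <=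
  2 ^+ n.+1 * 2 ^+ n.+1.
Proof.
rewrite mem_compositions => /and3P[/eqP size_c c_gt0 _] c_gt1.
apply: le_trans (ler_wpM2l _ (unit_sum_bound n P)); last by rewrite exprn_ge0.
rewrite mulr_sumr big_nat [leRHS]big_nat; apply: ler_sum => p /andP[p_gt0 _].
rewrite mulr_suml mulr_sumr big_seq [leRHS]big_seq; apply: ler_sum => s.
rewrite mem_compositions => /and3P[/eqP size_s s_gt0 /eqP sum_s].
rewrite normrM -size_s ler_pM ?norm_numer // normfV.
rewrite (ger0_norm (ltW (denom_gt0 _ _ s_gt0))).
have p_pos : 0 < p%:R :> K by rewrite ltr0n.
rewrite mulrC -invfM lef_pV2 ?posrE ?mulr_gt0 ?denom_gt0 //.
by rewrite -sum_s size_s -size_c denom_admissible_le.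
Qed.
End AbsoluteBound.

(** * Index sets and summation variables as lists *)

Definition rev_parts (n : nat) (F : 'I_n -> nat) : seq nat :=
  rev [seq F i | i <- enum 'I_n].

(** Extension by 0 to all of [nat] lets an induction change n while the function stays fixed. *)
Definition extend (n : nat) (F : 'I_n -> nat) (i : nat) : nat :=
  nth 0%N [seq F i | i <- enum 'I_n] i.

Lemma extendE (n : nat) (F : 'I_n -> nat) (i : 'I_n) : extend n F i = F i.
Proof. by rewrite /extend (nth_map i) ?size_enum_ord // nth_ord_enum. Qed.

Lemma rev_partsE (n : nat) (F : 'I_n -> nat) :
  rev_parts n F = rev (mkseq (extend n F) n).
Proof.
rewrite /rev_parts -[in LHS](mkseq_nth 0%N [seq F i | i <- enum 'I_n]).
by rewrite size_map size_enum_ord.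
Qed.

Lemma size_rev_parts (n : nat) (F : 'I_n -> nat) : size (rev_parts n F) = n.
Proof. by rewrite size_rev size_map size_enum_ord. Qed.

Lemma all_rev_parts (n : nat) (F : 'I_n -> nat) :
  all (leq 1) (rev_parts n F) = [forall i, (0 < F i)%N].
Proof.
rewrite all_rev all_map; apply/allP/forallP => [H i|H i _]; last exact: H.
by apply: H; rewrite mem_enum.
Qed.

Lemma sumn_rev_parts (n : nat) (F : 'I_n -> nat) :
  sumn (rev_parts n F) = (\sum_i F i)%N.
Proof. by rewrite sumn_rev sumnE big_map big_enum. Qed.

Lemma nth_rev_rev_parts (n : nat) (F : 'I_n -> nat) (i : 'I_n) :
  nth 0%N (rev (rev_parts n F)) i = F i.
Proof. by rewrite revK; exact: extendE. Qed.

Lemma head_rev_parts (n : nat) (F : 'I_n.+1 -> nat) :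
  head 0%N (rev_parts n.+1 F) = F ord_max.
Proof. by rewrite /rev_parts enum_ordSr map_rcons rev_rcons. Qed.

Lemma rev_parts_nth (n : nat) (s : seq nat) (F : 'I_n -> nat) :
  size s = n -> (forall i : 'I_n, F i = nth 0%N (rev s) i) -> rev_parts n F = s.
Proof.
move=> size_s Fs; rewrite /rev_parts -[RHS]revK; congr rev.
apply: (@eq_from_nth _ 0%N) => [|j]; rewrite size_map size_enum_ord.
  by rewrite size_rev size_s.
by move=> j_lt; rewrite -(Fs (Ordinal j_lt)); exact: (extendE n F (Ordinal j_lt)).
Qed.

Lemma mem_rev_parts (n p : nat) (F : 'I_n -> nat) :
  (rev_parts n F \in compositions n p) =
  [forall i, (0 < F i)%N] && (\sum_i F i == p)%N.
Proof.
by rewrite mem_compositions size_rev_parts eqxx all_rev_parts sumn_rev_parts.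
Qed.

Lemma denom_rev_mkseq (K : numFieldType) (n : nat) (g h : nat -> nat) :
  denom K (rev (mkseq g n)) (rev (mkseq h n)) =
  \prod_(j < n) ((\sum_(0 <= i < j.+1) g i)%N)%:R ^+ h j.
Proof.
elim: n => [|n IHn]; first by rewrite big_ord0.
rewrite big_ord_recr /= -IHn !mkseqS !rev_rcons /= mulrC; congr (_ * _%:R ^+ _).
by rewrite sumn_rev sumnE big_map big_nat_recr //= addnC /index_iota subn0.
Qed.

(** By hypothesis r is the first place, counted from 1, whose exponent is not 1. So [numer] gains a
    new term exactly while n < r, and after that the product stops growing. *)
Lemma numer_rev_mkseq (K : numFieldType) (t : K) (n r : nat) (g h : nat -> nat) :
  (forall i, (i.+1 < r)%N -> h i = 1%N) -> h r.-1 <> 1%N -> (0 < r)%N ->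
  numer K t (rev (mkseq g n)) (rev (mkseq h n)) =
  1 - \prod_(0 <= i < minn n r) (1 - t ^+ g i).
Proof.
move=> h1 hr r_gt0; elim: n => [|n IHn]; first by rewrite min0n big_geq // subrr.
rewrite !mkseqS !rev_rcons /= IHn all_rev.
have [nr|rn] := ltnP n r.
  rewrite (minn_idPl nr) big_nat_recr //=.
  have -> : all (pred1 1%N) (mkseq h n).
    apply/allP => _ /mapP[i + ->] /=; rewrite mem_iota => /andP[_ i_lt].
    by rewrite h1 // (leq_ltn_trans _ nr).
  by rewrite big_rev big_map /index_iota subn0 mul1r; ring.
rewrite (minn_idPr (leqW rn)).
have -> : all (pred1 1%N) (mkseq h n) = false.
  apply/negbTE/allPn; exists (h r.-1); last by apply/eqP.
  by apply/mapP; exists r.-1 => //; rewrite mem_iota add0n prednK.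
by rewrite mul0r addr0.
Qed.

Lemma mterm_lists (K : numFieldType) (n k r : nat) (kk : {ffun 'I_n -> 'I_k.+1})
    (t : K) (m : {ffun 'I_n -> nat}) :
  (0 < r <= n)%N -> kk \in index_set' n k r ->
  mterm r kk t m =
  let s := rev_parts n (fun i => (m i).+1) in
  let c := rev_parts n (fun i => kk i : nat) in numer K t s c / denom K s c.
Proof.
move=> /andP[r_gt0 rn]; rewrite !inE => /andP[notin /and5P[_ kk_gt0 kk_last kk_sum ones]].
rewrite /= !rev_partsE denom_rev_mkseq (numer_rev_mkseq _ _ _ r) //; last 2 first.
- move=> j ir; have j_lt : (j < n)%N by lia.
  rewrite (extendE _ _ (Ordinal j_lt)).
  by have /forallP/(_ (Ordinal j_lt))/implyP/(_ ir)/eqP := ones.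
- have r1_lt : (r.-1 < n)%N by lia.
  rewrite (extendE _ _ (Ordinal r1_lt)) => kkr1.
  (* For r = n the exponent k_r differs from 1 because k_n >= 2; for r < n, k_r = 1 would put [kk]
     into the set that was removed. *)
  have [rltn|nr] := ltnP r n; last first.
    have /forallP/(_ (Ordinal r1_lt))/implyP := kk_last.
    by rewrite kkr1 /= prednK // => /(_ _)/implyP; rewrite eqn_leq rn nr => /(_ isT).
  case/negP: notin; rewrite rltn kk_gt0 kk_last kk_sum /=.
  apply/forallP => i; apply/implyP => ir.
  have [ir1|ir1] := ltnP i.+1 r.
    by have /forallP/(_ i)/implyP/(_ ir1) := ones.
  by rewrite (_ : i = Ordinal r1_lt) ?kkr1 //; apply: val_inj => /=; lia.
rewrite /mterm (minn_idPr rn); congr (_ / _).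
  congr (1 - _); rewrite big_mkord.
  rewrite (big_ord_widen n (fun i => 1 - t ^+ extend n (fun i => (m i).+1) i)) //.
  by apply: eq_bigr => i _; rewrite extendE.
apply: eq_bigr => j _; rewrite extendE; congr (_%:R ^+ _).
rewrite big_mkord (big_ord_widen n (extend n (fun i => (m i).+1))) //.
by apply: eq_big => i; rewrite ?ltnS // extendE.
Qed.

Lemma index_set_succ_sub (n k r : nat) : (index_set n k r.+1 \subset index_set n k r)%SET.
Proof.
apply/fintype.subsetP => kk; rewrite !inE => /and5P[rn -> -> -> ones] /=.
rewrite (ltnW rn); apply/forallP => i; apply/implyP => ir.
by have /forallP/(_ i)/implyP := ones; apply; lia.
Qed.

(** The sets I(r) decrease, so the sums over their differences telescope, and I(n + 1) is empty. *)
Lemma sum_index_set' (V : zmodType) (n k : nat) (F : {ffun 'I_n -> 'I_k.+1} -> V) :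
  \sum_(1 <= r < n.+1) \sum_(kk in index_set' n k r) F kk =
  \sum_(kk in index_set n k 1) F kk.
Proof.
pose S r := \sum_(kk in index_set n k r) F kk.
rewrite (@eq_big_nat _ _ _ _ _ _ (fun r => - S r.+1 - - S r)) => [|r _]; last first.
  rewrite opprK addrC /S [X in _ = X - _](big_setID (index_set n k r.+1)) /=.
  by rewrite (finset.setIidPr (index_set_succ_sub n k r)) addrC addrK.
rewrite telescope_sumr // opprK addrC /S [X in _ - X]big_pred0 ?subr0 // => kk.
by rewrite !inE ltnn.
Qed.

Lemma index_set_compositions (n k r : nat) (kk : {ffun 'I_n.+1 -> 'I_k.+1}) :
  kk \in index_set n.+1 k r ->
  let c := rev_parts n.+1 (fun i => kk i : nat) in
  c \in compositions n.+1 k /\ (1 < head 0 c)%N.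
Proof.
rewrite inE => /and5P[_ kk_gt0 kk_last kk_sum _] /=.
rewrite mem_rev_parts kk_gt0 kk_sum head_rev_parts; split=> //.
by have /forallP/(_ ord_max)/implyP := kk_last; apply.
Qed.

Lemma sum_index_set (V : nmodType) (n k : nat) (G : seq nat -> V) :
  \sum_(kk in index_set n.+1 k 1) G (rev_parts n.+1 (fun i => kk i : nat)) =
  \sum_(c <- compositions n.+1 k | (1 < head 0 c)%N) G c.
Proof.
pose parts (kk : {ffun 'I_n.+1 -> 'I_k.+1}) := rev_parts n.+1 (fun i => kk i : nat).
rewrite -big_enum -(big_map parts predT G) -[RHS]big_filter; apply: perm_big.
apply: uniq_perm.
- rewrite map_inj_uniq ?enum_uniq // => kk kk' eq_parts; apply/ffunP => i.
  apply: val_inj; rewrite /= -(nth_rev_rev_parts _ (fun i => kk i : nat)).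
  by rewrite -/(parts kk) eq_parts nth_rev_rev_parts.
- by rewrite filter_uniq // uniq_compositions.
move=> c; rewrite mem_filter; apply/mapP/andP => [[kk + ->]|[c_gt1 c_in]].
  by rewrite mem_enum => /index_set_compositions[].
have := c_in; rewrite mem_compositions => /and3P[/eqP size_c c_gt0 /eqP sum_c].
(* Every entry of [c] is at most the total k, so [inord] keeps its value. *)
pose kk : {ffun 'I_n.+1 -> 'I_k.+1} := [ffun i : 'I_n.+1 => inord (nth 0%N (rev c) i)].
have kkE (i : 'I_n.+1) : kk i = nth 0%N (rev c) i :> nat.
  rewrite ffunE inordK // ltnS -sum_c -sumn_rev.
  have : (i < size (rev c))%N by rewrite size_rev size_c.
  elim: (rev c) (nat_of_ord i) => [|a s IHs] [|j] //= js; rewrite ?leq_addr //.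
  by rewrite (leq_trans (IHs _ js)) ?leq_addl.
have partsE : parts kk = c by exact: rev_parts_nth.
exists kk; last by rewrite partsE.
rewrite mem_enum !inE /=; move: c_in; rewrite -partsE mem_rev_parts => /andP[-> ->].
rewrite /=; apply/andP; split; apply/forallP => i; last by [].
apply/implyP; rewrite eqSS => /eqP i_eq; move: c_gt1; rewrite -partsE head_rev_parts.
by rewrite (_ : i = ord_max) //; apply: val_inj.
Qed.

(** * Growth of the harmonic numbers *)

Lemma harmonic_sumS (K : numFieldType) (P : nat) :
  harmonic_sum K P.+1 = harmonic_sum K P + P.+1%:R^-1.
Proof. by rewrite /harmonic_sum big_nat_recr. Qed.

(** The induction step is exp(1 / (P + 2)) <= (P + 2) / (P + 1), which is exp(-x) >= 1 - x at x = 1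
    / (P + 2). *)
Lemma expR_harmonic_sum (R : realType) (P : nat) :
  expR (harmonic_sum R P.+1) <= expR 1 * P.+1%:R.
Proof.
elim: P => [|P IHP]; first by rewrite /harmonic_sum big_nat1 invr1 mulr1.
rewrite harmonic_sumS expRD.
have x_gt0 : 0 < P.+1%:R / P.+2%:R :> R by rewrite divr_gt0 ?ltr0n.
have tail : expR (P.+2%:R^-1 : R) <= P.+2%:R / P.+1%:R.
  rewrite -[leRHS]invf_div -[leLHS]invrK -expRN lef_pV2 ?posrE ?expR_gt0 //.
  apply: le_trans (expR_ge1Dx _); rewrite -[P.+2%:R]natr1 ler_pdivrMr; last first.
    by rewrite natr1 ltr0n.
  by rewrite mulrBl mul1r mulVf ?addrK // natr1 pnatr_eq0.
apply: le_trans (ler_pM _ _ IHP tail) _; rewrite ?expR_ge0 //.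
by rewrite mulrA mulrAC mulfK ?pnatr_eq0.
Qed.

Lemma harmonic_sum_pow_le (R : realType) (m P : nat) :
  harmonic_sum R P ^+ m.+1 <= (m.+1)`!%:R * expR 1 * P.+1%:R.
Proof.
have fact_gt0 : 0 < (m.+1)`!%:R :> R by rewrite ltr0n fact_gt0.
rewrite -mulrA -ler_pdivrMl // mulrC; apply: (@le_trans _ _ (expR (harmonic_sum R P))).
  by apply: le_trans (expR_ge1Dxn m (harmonic_sum_ge0 R P)); rewrite lerDr.
apply: le_trans (expR_harmonic_sum R P).
by rewrite ler_expR harmonic_sumS lerDl invr_ge0 ler0n.
Qed.

(** Squares are compared: H_P^(2n) is at most C (P + 1) by [harmonic_sum_pow_le], so the square of
    the quantity is O(1 / P). *)
Lemma harmonic_pow_small (R : realType) (c : R) (n : nat) (e : R) : 0 <= c -> 0 < e ->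
  \forall P \near \oo, c * harmonic_sum R P ^+ n / P.+1%:R < e.
Proof.
move=> c_ge0 e_gt0; pose C : R := (n.*2.+1)`!%:R * expR 1.
have C_ge0 : 0 <= C by rewrite mulr_ge0 ?expR_ge0 ?ler0n.
near=> P.
have P_gt0 : (0 < P)%N by near: P; exists 1%N.
have H_ge1 := harmonic_sum_ge1 R P P_gt0; have H_ge0 := harmonic_sum_ge0 R P.
have S_gt0 : 0 < P.+1%:R :> R by rewrite ltr0n.
have H_le : harmonic_sum R P ^+ n.*2 <= C * P.+1%:R.
  apply: (@le_trans _ _ (harmonic_sum R P ^+ n.*2.+1)); first by rewrite ler_weXn2l.
  exact: harmonic_sum_pow_le.
rewrite -(@ltr_pXn2r _ 2) ?nnegrE ?(ltW e_gt0) //; last first.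
  by rewrite divr_ge0 ?mulr_ge0 ?exprn_ge0 ?(ltW S_gt0).
rewrite !exprMn -exprM muln2 exprVn -mulrA.
apply: (@le_lt_trans _ _ (c ^+ 2 * (C / P.+1%:R))).
  rewrite ler_wpM2l ?exprn_ge0 // ler_pdivrMr ?exprn_gt0 //.
  by rewrite expr2 mulrA mulfVK ?gt_eqF.
rewrite mulrA ltr_pdivrMr // [ltRHS]mulrC -ltr_pdivrMr ?exprn_gt0 //.
apply: (@le_lt_trans _ _ P%:R); last by rewrite ltr_nat.
near: P; exact: nbhs_infty_ger.
Unshelve. all: by end_near.
Qed.

(** * Multiple series as limits over simplices *)

(** The function m stores each summation variable less 1, hence the predecessor. *)
Definition of_parts (n : nat) (s : seq nat) : {ffun 'I_n -> nat} :=
  [ffun i : 'I_n => (nth 0%N (rev s) i).-1].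

Definition parts (n : nat) (m : {ffun 'I_n -> nat}) : seq nat :=
  rev_parts n (fun i => (m i).+1).

Lemma partsK (n : nat) : cancel (parts n) (of_parts n).
Proof. by move=> m; apply/ffunP => i; rewrite ffunE nth_rev_rev_parts. Qed.

Lemma of_partsK (n p : nat) (s : seq nat) :
  s \in compositions n p -> parts n (of_parts n s) = s.
Proof.
rewrite mem_compositions => /and3P[/eqP size_s s_gt0 _].
apply: rev_parts_nth => // i; rewrite ffunE prednK //.
by apply: (allP s_gt0); rewrite -mem_rev mem_nth // size_rev size_s.
Qed.

Lemma mem_parts (n p : nat) (m : {ffun 'I_n -> nat}) :
  (parts n m \in compositions n p) = (\sum_i (m i).+1 == p)%N.
Proof. by rewrite mem_rev_parts; case: forallP => // -[]. Qed.

Definition compositions_upto (n P : nat) : seq (seq nat) :=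
  [seq s | p <- index_iota 1 P.+1, s <- compositions n p].

Definition simplex (n P : nat) : {fset {ffun 'I_n -> nat}} :=
  seq_fset tt [seq of_parts n s | s <- compositions_upto n P].

Lemma uniq_compositions_upto (n P : nat) : uniq (compositions_upto n P).
Proof.
apply: (@allpairs_uniq_dep _ (fun=> seq nat)) => [|p _|];
  rewrite ?iota_uniq ?uniq_compositions //.
move=> _ _ /allpairsPdep[p [s [_ sp ->]]] /allpairsPdep[q [s' [_ sq ->]]] /= ss'.
move: sp sq; rewrite -{}ss' !mem_compositions => /and3P[_ _ /eqP sp] /and3P[_ _ /eqP sq].
by rewrite -sp -sq.
Qed.

Lemma partial_sum_simplex (V : zmodType) (n P : nat) (G : seq nat -> V) :
  partial_sum (G \o parts n) (simplex n P) =
  \sum_(1 <= p < P.+1) \sum_(s <- compositions n p) G s.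
Proof.
have eq_simplex : perm_eq (enum_fset (simplex n P))
    [seq of_parts n s | s <- compositions_upto n P].
  apply: uniq_perm => [||m]; [exact: fset_uniq| |exact: seq_fsetE].
  rewrite map_inj_in_uniq ?uniq_compositions_upto //.
  move=> _ _ /allpairsPdep[p [s [_ sp ->]]] /allpairsPdep[q [s' [_ sq ->]]] eq_s.
  by rewrite -(of_partsK _ _ _ sp) eq_s (of_partsK _ _ _ sq).
rewrite /partial_sum -(big_seq_fsetE _ _ predT) (perm_big _ eq_simplex).
rewrite big_map big_allpairs_dep /=; apply: eq_bigr => p _.
rewrite [LHS]big_seq [RHS]big_seq; apply: eq_bigr => s sp.
by rewrite (of_partsK _ _ _ sp).
Qed.

(** The threshold is the largest total of an element of A. With at least one variable every total is
    positive, so starting the totals at 1 loses nothing. *)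
Lemma simplex_cofinal (n : nat) (A : {fset {ffun 'I_n.+1 -> nat}}) :
  \forall P \near \oo, (A `<=` simplex n.+1 P)%fset.
Proof.
exists (\max_(m <- A) \sum_i (m i).+1)%N => // P /= AP.
apply/fsubsetP => m mA; rewrite seq_fsetE.
apply/mapP; exists (parts n.+1 m); last by rewrite partsK.
apply/allpairsPdep; exists (\sum_i (m i).+1)%N, (parts n.+1 m).
split=> //; last by rewrite mem_parts.
rewrite mem_index_iota ltnS big_ord_recl addSn ltnS leq0n.
rewrite -addSn -(big_ord_recl _ (fun i => (m i).+1)) /=.
apply: leq_trans AP.
by apply: (@leq_bigmax_seq _ _ predT (fun m : {ffun _} => \sum_i (m i).+1)%N).
Qed.

Lemma simplex_totally (n : nat) : simplex n.+1 @ \oo --> totally.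
Proof.
move=> U [A _ AU]; have := simplex_cofinal n A.
by apply: filterS => P AP; apply: AU.
Qed.

Lemma multi_sum_simplex (K : numFieldType) (n : nat) (f : {ffun 'I_n.+1 -> nat} -> K) :
  multi_summable f ->
  partial_sum f (simplex n.+1 P) @[P --> \oo] --> multi_sum f.
Proof. by move=> f_cvg; apply: cvg_comp (simplex_totally n) f_cvg. Qed.

(* Summability of dominated families *)
#[local] Existing Instance totally_filter.

Lemma partial_sumE (V : zmodType) (I : choiceType) (f : I -> V) (A : {fset I}) :
  partial_sum f A = \sum_(i <- A) f i.
Proof. by rewrite /partial_sum -(big_seq_fsetE _ _ predT). Qed.

Lemma partial_sum_le (K : numFieldType) (I : choiceType) (f : I -> K) (A B : {fset I}) :
  (forall i, 0 <= f i) -> (A `<=` B)%fset -> partial_sum f A <= partial_sum f B.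
Proof.
move=> f_ge0 /fsubsetP AB; rewrite !partial_sumE [leRHS](bigID (mem A)) /=.
have eq_A : perm_eq (enum_fset A) [seq i <- enum_fset B | i \in A].
  apply: uniq_perm; rewrite ?filter_uniq ?fset_uniq // => i.
  by rewrite mem_filter; apply/esym/andb_idr; exact: AB.
by rewrite (perm_big _ eq_A) big_filter lerDl sumr_ge0.
Qed.

Lemma cvg_partial_sum_ge0 (R : realType) (I : choiceType) (g : I -> R) (M : R) :
  (forall i, 0 <= g i) -> (forall A, partial_sum g A <= M) ->
  cvg (partial_sum g @ totally).
Proof.
move=> g_ge0 gM; pose S := range (partial_sum g).
have S_sup : has_sup S.
  split; first by exists (partial_sum g fset0); exists fset0.
  by exists M => _ [A _ <-].
apply/cvg_ex; exists (sup S); apply/cvgrPdist_lt => e e_gt0.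
have [_ [A _ <-] SA] := sup_adherent e_gt0 S_sup.
exists A => // B /= AB; have AB_le := partial_sum_le _ _ _ _ _ g_ge0 AB.
have B_le : partial_sum g B <= sup S by apply: ub_le_sup; [case: S_sup|exists B].
by rewrite ger0_norm ?subr_ge0 // ltrBlDr -ltrBlDl (lt_le_trans SA).
Qed.

(** Write f as (f + g) - g: both f + g and g are nonnegative with bounded partial sums. *)
Lemma cvg_partial_sum_dominated (R : realType) (I : choiceType) (f g : I -> R) (M : R) :
  (forall i, `|f i| <= g i) -> (forall A, partial_sum g A <= M) ->
  cvg (partial_sum f @ totally).
Proof.
move=> fg gM.
have g_ge0 i : 0 <= g i by apply: le_trans (fg i).
have -> : partial_sum f = partial_sum (fun i => f i + g i) - partial_sum g.
  by apply/funext => A; rewrite fctE /partial_sum big_split /= addrK.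
apply: is_cvgB; last exact: cvg_partial_sum_ge0 gM.
apply: (@cvg_partial_sum_ge0 _ _ _ (M + M)) => [i|A].
  by have := fg i; rewrite ler_norml => /andP[+ _]; rewrite -subr_ge0 opprK.
rewrite /partial_sum big_split lerD //=; last exact: gM.
apply: le_trans (gM A); apply: ler_sum => i _.
by apply: le_trans (fg _); rewrite ler_norm.
Qed.

Lemma norm_Re_le (R : realType) (z : R[i]) : `|complex.Re z| <= complex.Re `|z|.
Proof. by have := normc_ge_Re z; rewrite lecE => /andP[]. Qed.

Lemma norm_Im_le (R : realType) (z : R[i]) : `|complex.Im z| <= complex.Re `|z|.
Proof. by rewrite normc_def /= -sqrtr_sqr ler_wsqrtr // lerDr sqr_ge0. Qed.

Lemma norm_le_Re_Im (R : realType) (z : R[i]) :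
  `|z| <= (`|complex.Re z| + `|complex.Im z|)%:C.
Proof.
rewrite normc_def lecR -[leRHS]ger0_norm ?addr_ge0 // -[leRHS]sqrtr_sqr ler_wsqrtr //.
rewrite sqrrD !real_normK ?num_real //.
by rewrite addrAC lerDl mulrn_wge0 ?mulr_ge0.
Qed.

Lemma cvg_complex (R : realType) (T : Type) (F : set_system T) {FF : Filter F}
    (f : T -> (R[i] : numFieldType)) (a b : R) :
  complex.Re (f x) @[x --> F] --> a -> complex.Im (f x) @[x --> F] --> b ->
  f @ F --> (a +i* b : (R[i] : numFieldType)).
Proof.
move=> /cvgrPdist_lt Ref /cvgrPdist_lt Imf; apply/cvgrPdist_lt => e.
(* In the order on [R[i]], 0 < e means that e is real and positive. *)
rewrite ltcE /= => /andP[/eqP Im_e e_gt0].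
have e2_gt0 : 0 < complex.Re e / 2 by rewrite divr_gt0.
apply: filterS2 (Ref _ e2_gt0) (Imf _ e2_gt0) => x Rex Imx.
apply: le_lt_trans (norm_le_Re_Im _ _) _.
rewrite ltcE /= Im_e eqxx /= [complex.Re e]splitr.
by move: Rex Imx; case: (f x) => c d; exact: ltrD.
Qed.

Lemma bounded_multi_summable (R : realType) (I : choiceType)
    (f : I -> (R[i] : numFieldType)) (M : R) :
  (forall A, partial_sum (fun i => `|f i|) A <= M%:C) -> multi_summable f.
Proof.
move=> fM.
have ReE (g : I -> R[i]) A :
    complex.Re (partial_sum g A) = partial_sum (fun i => complex.Re (g i)) A.
  exact: (raddf_sum (@complex.Re R : Rcomplex R -> R)).
have ImE (g : I -> R[i]) A :
    complex.Im (partial_sum g A) = partial_sum (fun i => complex.Im (g i)) A.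
  exact: (raddf_sum (@complex.Im R : Rcomplex R -> R)).
have normM A : partial_sum (fun i => complex.Re `|f i|) A <= M.
  by have := fM A; rewrite lecE ReE => /andP[].
have /cvg_ex[/= a Ha] :=
  cvg_partial_sum_dominated _ _ _ _ _ (fun i => norm_Re_le _ (f i)) normM.
have /cvg_ex[/= b Hb] :=
  cvg_partial_sum_dominated _ _ _ _ _ (fun i => norm_Im_le _ (f i)) normM.
apply/cvg_ex; exists (a +i* b); apply: cvg_complex.
  by under eq_fun do rewrite ReE.
by under eq_fun do rewrite ImE.
Qed.

(** * Both sides as limits of truncated sums *)

Lemma partial_sum_mterm (K : numFieldType) (n k r P : nat)
    (kk : {ffun 'I_n.+1 -> 'I_k.+1}) (t : K) :
  (0 < r <= n.+1)%N -> kk \in index_set' n.+1 k r ->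
  let c := rev_parts n.+1 (fun i => kk i : nat) in
  partial_sum (mterm r kk t) (simplex n.+1 P) =
  \sum_(1 <= p < P.+1) \sum_(s <- compositions n.+1 p) numer K t s c / denom K s c.
Proof.
move=> rn kk_in c; rewrite -partial_sum_simplex; congr (partial_sum _ _).
by apply/funext => m; rewrite (mterm_lists _ _ _ _ _ _ _ rn kk_in).
Qed.

(** Every finite set of indices lies in a simplex, and there [absolute_bound] gives a bound
    independent of P. *)
Lemma mterm_multi_summable (R : realType) (n k r : nat)
    (kk : {ffun 'I_n.+1 -> 'I_k.+1}) (t : (R[i] : numFieldType)) :
  `|t| <= 1 -> (0 < r <= n.+1)%N -> kk \in index_set' n.+1 k r ->
  multi_summable (mterm r kk t).
Proof.
move=> t_le1 rn kk_in.
apply: (@bounded_multi_summable _ _ _ (2 ^+ n.+1 * 2 ^+ n.+1)) => A.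
have [P AP] := filter_ex (simplex_cofinal n A).
apply: (le_trans (partial_sum_le _ _ _ _ _ _ AP)) => [m|]; first exact: normr_ge0.
have /index_set_compositions[c_in c_gt1] : kk \in index_set n.+1 k r.
  by move: kk_in; rewrite inE => /andP[].
rewrite rmorphM rmorphXn rmorph_nat.
apply: le_trans (absolute_bound _ _ t_le1 n k P _ c_in c_gt1).
rewrite -(partial_sum_simplex _ _ _ (fun s => `|numer _ t s _ / denom _ s _|)).
rewrite le_eqVlt; apply/orP; left; apply/eqP; congr (partial_sum _ _).
by apply/funext => m; rewrite (mterm_lists _ _ _ _ _ _ _ rn kk_in).
Qed.

Lemma cvg_sum_seq (K : numFieldType) (I : Type) (s : seq I) (Q : pred I)
    (f : I -> nat -> K) (l : I -> K) :
  (forall i, Q i -> f i @ \oo --> l i) ->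
  \sum_(i <- s | Q i) f i P @[P --> \oo] --> \sum_(i <- s | Q i) l i.
Proof.
move=> fl; elim: s => [|i s IHs].
  by rewrite big_nil; under eq_fun do rewrite big_nil; exact: cvg_cst.
rewrite big_cons; under eq_fun do rewrite big_cons.
by case: ifP => // Qi; apply: cvgD => //; exact: fl.
Qed.

Lemma truncated_sum_mterm (K : numFieldType) (n k P : nat) (t : K) :
  \sum_(1 <= r < n.+2) \sum_(kk in index_set' n.+1 k r)
    partial_sum (mterm r kk t) (simplex n.+1 P) = truncated_sum K t n k P.
Proof.
pose G c := \sum_(1 <= p < P.+1) \sum_(s <- compositions n.+1 p)
  numer K t s c / denom K s c.
rewrite /truncated_sum exchange_big -(sum_index_set _ n k G) -sum_index_set'.
apply: eq_big_nat => r rn; apply: eq_bigr => kk kk_in.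
exact: partial_sum_mterm.
Qed.

Lemma harmonic_sum_complex (R : realType) (P : nat) :
  harmonic_sum R[i] P = (harmonic_sum R P)%:C.
Proof.
rewrite /harmonic_sum rmorph_sum; apply: eq_bigr => i _.
by rewrite fmorphV rmorph_nat.
Qed.

Theorem theorem1p2 (R : realType) (n k : nat) (hn : (0 < n)%N) (hk : (n < k)%N)
    (t : R[i]) (ht : `|t| <= 1) :
  [/\ (forall (r : nat) (kk : {ffun 'I_n -> 'I_k.+1}),
         (1 <= r <= n)%N -> kk \in index_set' n k r ->
         multi_summable (mterm r kk t)),
      cvg (polylog_partial k t @ \oo) &
      \sum_(1 <= r < n.+1) \sum_(kk in index_set' n k r)
         multi_sum (mterm r kk t) = polylog k t].
Proof.
case: n hn hk => // n _ nk.
set L := (X in X = _).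
(* L is a finite sum of multiple series, so it is the limit of their joint truncation to the
   simplices. *)
have sum_cvg : truncated_sum _ t n k P @[P --> \oo] --> L.
  under eq_fun do rewrite -truncated_sum_mterm big_nat.
  rewrite /L big_nat; apply: cvg_sum_seq => r rn; apply: cvg_sum_seq => kk kk_in.
  exact/multi_sum_simplex/mterm_multi_summable.
(* [polylog_partial] at P.+1 ends with m = P, which matches the cut-off of [truncated_sum]. *)
have diff_cvg : truncated_sum _ t n k P - polylog_partial k t P.+1 @[P --> \oo] -->
    (0 : (R[i] : numFieldType)).
  apply/cvgr0Pnorm_lt => e; rewrite ltcE /= => /andP[/eqP Im_e e_gt0].
  have c_ge0 : 0 <= n%:R * 2 ^+ n.+2 :> R by rewrite mulr_ge0 ?exprn_ge0.
  near=> P.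
  have P_gt0 : (0 < P)%N by near: P; exists 1%N.
  apply: le_lt_trans (truncated_sum_bound _ _ n k P nk ht P_gt0) _.
  have castE (c H x : R) : c%:C * H%:C ^+ n / x%:C = (c * H ^+ n / x)%:C.
    by rewrite fmorph_div rmorphM rmorphXn.
  have -> : n%:R * 2 ^+ n.+2 = (n%:R * 2 ^+ n.+2)%:C :> R[i].
    by rewrite -!natrX -!natrM rmorph_nat.
  rewrite harmonic_sum_complex -(rmorph_nat (real_complex R)) castE.
  rewrite ltcE /= Im_e eqxx /=; near: P.
  exact: harmonic_pow_small.
(* The partial sums of the polylogarithm are the truncated sums minus a null sequence; this gives
   both their convergence and their limit. *)
have polylog_cvg : polylog_partial k t @ \oo --> L.
  rewrite -cvg_shiftS -[L]subr0.
  under eq_fun => P do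
    rewrite -[polylog_partial k t P.+1](subKr (truncated_sum _ t n k P)).
  exact: (cvgB sum_cvg diff_cvg).
split=> [r kk rn kk_in||].
- exact: mterm_multi_summable.
- by apply/cvg_ex; exists L.
- by apply/esym/cvg_lim.
Unshelve. all: by end_near.
Qed.
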